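(* For any integers $a,b\geq 0$ and for any prime $p>2t+1$ with $t=a+b+1$, the following two congruences hold: $$H_{p-1}^q(\{2\}^a,3,\{2\}^b)+H_{p-1}^q(\{2\}^b,3,\{2\}^a)\equiv(-1)^{t-1}\binom{p+t}{2t+1}\frac{(1-q)^{2t+1}}{p(t+1)}\pmod{[p]_q},$$ $$S_{p-1}^q(\{2\}^a,3,\{2\}^b)+S_{p-1}^q(\{2\}^b,3,\{2\}^a)\equiv-(1-q)^{2t+1}\sum_{i=0}^t\left(t\binom{t-1}{i}+(t-1)\binom{t}{i}\right)(-1)^{i}K_{2t-i}(p)\pmod{[p]_q}.$$
   Context: Here $q$ is an indeterminate and $[n]_q=\frac{1-q^n}{1-q}=1+q+\cdots+q^{n-1}$. For positive integers $s_1,\dots,s_l$, $$H_n^q(s_1,\ldots,s_l)=\sum_{1\le k_1<\cdots<k_l\le n}\prod_{i=1}^l\frac{q^{(s_i-1)k_i}}{[k_i]_q^{s_i}},\qquad S_n^q(s_1,\ldots,s_l)=\sum_{1\le k_1\le\cdots\le k_l\le n}\prod_{i=1}^l\frac{q^{(s_i-1)k_i}}{[k_i]_q^{s_i}}.$$ $\{s\}^t$ denotes $t\ge0$ consecutive copies of $s$. The rational numbers $K_n(p)$ ($n\ge0$) are defined by the expansion about $z=1$ $$\frac{p(z-1)}{z^p-1}=\sum_{n=0}^{\infty}(-1)^{n-1}K_n(p)(z-1)^n$$ (so $K_0(p)=-1$, $K_1(p)=-\frac{p-1}{2}$, $K_2(p)=-\frac{p^2-1}{12}$). For a prime $p$ and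 rational functions $A,B$ in $q$, $A\equiv B\pmod{[p]_q}$ means $A-B=f/g$ with $f,g$ polynomials in $q$ with integer coefficients, $g$ coprime to $[p]_q$ in $\mathbb{Q}[q]$, and $[p]_q\mid f$ ($[p]_q$ is the $p$th cyclotomic polynomial, irreducible over $\mathbb{Q}$). *)

(* Defs.v *)
From mathcomp Require Import all_boot all_order all_algebra.

Set Implicit Arguments.
Unset Strict Implicit.
Unset Printing Implicit Defensive.

Import Order.TTheory GRing.Theory Num.Theory.
Local Open Scope ring_scope.

(* The field Q(q) of rational functions; q is the polynomial variable. *)
Definition ratfun := {fraction {poly rat}}.
Definition ratq : ratfun := tofrac 'X.
Definition ratconst (c : rat) : ratfun := tofrac c%:P.

Definition qnum (n : nat) : {poly rat} := \sum_(i < n) 'X^i.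

Lemma qnumE (n : nat) : tofrac (qnum n) = (1 - ratq ^+ n) / (1 - ratq).
Proof.
have nz : 1 - ratq != 0.
  rewrite /ratq -tofrac1 -tofracB tofrac_eq0 -opprB oppr_eq0.
  by rewrite -polyC1 polyXsubC_eq0.
apply/(mulIf nz); rewrite divfK //.
rewrite /ratq -tofrac1 -tofracXn -!tofracB -tofracM; congr tofrac.
rewrite -(opprB 'X) mulrN mulrC -(opprB 'X^n) subrX1; congr (- (_ * _)).
Qed.

(* A = B mod [p]_q.  Coprimality and divisibility are taken in Q[q]; as [p]_q
   is monic, it divides f in Z[q] if and only if it does in Q[q]. *)
Definition ratfun_eqmod (p : nat) (A B : ratfun) : Prop :=
  exists f g : {poly int},
    let fQ : {poly rat} := map_poly intr f in
    let gQ : {poly rat} := map_poly intr g in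
    [/\ coprimep gQ (qnum p), qnum p %| fQ & A - B = tofrac fQ / tofrac gQ].

(* Sum over the tuples 1 <= k_1, ..., k_l <= n whose consecutive entries are
   related by r. *)
Definition qsum (r : rel nat) (n : nat) (s : seq nat) : ratfun :=
  \sum_(k : (size s).-tuple 'I_n.+1 |
          all (fun x : 'I_n.+1 => 0 < x)%N k && sorted r [seq val x | x <- k])
    \prod_(i < size s)
      (ratq ^+ ((nth 0%N s i - 1) * tnth k i)%N
       / tofrac (qnum (tnth k i)) ^+ nth 0%N s i).

Definition Hq (n : nat) (s : seq nat) : ratfun := qsum ltn n s.
Definition Sq (n : nat) (s : seq nat) : ratfun := qsum leq n s.

(* u(z) / v(z) = \sum_n c_n (z - x)^n, i.e. v * (\sum_n c_n (z - x)^n) = u as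
   formal power series in z - x.  The Taylor coefficients of a polynomial w
   about x are the coefficients of w \Po ('X + x%:P). *)
Definition expansion_at (x : rat) (u v : {poly rat}) (c : nat -> rat) : Prop :=
  v != 0 /\
  forall n : nat,
    \sum_(i < n.+1) (v \Po ('X + x%:P))`_i * c (n - i)%N
      = (u \Po ('X + x%:P))`_n.

(* K is the sequence n |-> K_n(p); the exponent n - 1 is an integer, equal
   to -1 when n = 0. *)
Definition is_Kseq (p : nat) (K : nat -> rat) : Prop :=
  expansion_at 1 (p%:R *: ('X - 1)) ('X^p - 1)
    (fun n => (-1) ^ (n%:Z - 1) * K n).

Section PowerSeriesDivision.
Variables u v : nat -> rat.
Hypotheses (u0 : u 0%N = 0) (v0 : v 0%N = 0) (v1 : v 1%N != 0).

Fixpoint psdiv_seq (n : nat) : seq rat :=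
  if n is m.+1 then
    let l := psdiv_seq m in
    rcons l ((u m.+1 - \sum_(i < m) v i.+2 * l`_(m - i.+1)) / v 1%N)
  else [::].

Definition psdiv (n : nat) : rat := (psdiv_seq n.+1)`_n.

Lemma size_psdiv_seq n : size (psdiv_seq n) = n.
Proof. by elim: n => //= n IH; rewrite size_rcons IH. Qed.

Lemma nth_psdiv_seq n i : (i < n)%N -> (psdiv_seq n)`_i = psdiv i.
Proof.
elim: n => // n IH; rewrite ltnS leq_eqVlt => /orP[/eqP-> //|lt_in].
by rewrite /= nth_rcons size_psdiv_seq lt_in IH.
Qed.

Lemma psdivP n : \sum_(i < n.+1) v i * psdiv (n - i)%N = u n.
Proof.
case: n => [|n]; first by rewrite big_ord_recl big_ord0 v0 mul0r addr0 u0.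
rewrite big_ord_recl v0 mul0r add0r big_ord_recl /= subn1 /=.
rewrite {1}/psdiv /= nth_rcons size_psdiv_seq ltnn eqxx.
rewrite mulrC divfK //.
rewrite -[RHS](subrK (\sum_(i < n) v i.+2 * (psdiv_seq n)`_(n - i.+1))).
congr (_ + _); apply: eq_bigr => i _.
rewrite /bump /= !add1n subSS nth_psdiv_seq //.
by rewrite -subSn // subSS leq_subr.
Qed.

Lemma psdiv_uniq (c d : nat -> rat) :
  (forall n, \sum_(i < n.+1) v i * c (n - i)%N = u n) ->
  (forall n, \sum_(i < n.+1) v i * d (n - i)%N = u n) -> c =1 d.
Proof.
move=> hc hd n; elim/ltn_ind: n => n IH.
have := hc n.+1; rewrite -(hd n.+1).
rewrite big_ord_recl [in RHS]big_ord_recl v0 !mul0r !add0r.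
rewrite big_ord_recl [in RHS]big_ord_recl /= subn1 /=.
rewrite (eq_bigr (fun i : 'I_n => v (bump 0 (bump 0 i)) * d (n.+1 - bump 0 (bump 0 i))%N)).
  by move=> /addIr /(mulfI v1).
move=> i _; rewrite IH // /bump /= !add1n subSS.
by rewrite -subSn // subSS leq_subr.
Qed.

End PowerSeriesDivision.

Section KExists.
Variable p : nat.
Hypothesis p_gt0 : (0 < p)%N.

Let V := (('X^p - 1 : {poly rat}) \Po ('X + 1%:P)).
Let U := ((p%:R *: ('X - 1) : {poly rat}) \Po ('X + 1%:P)).

Let V0 : V`_0 = 0.
Proof.
by rewrite -horner_coef0 horner_comp !hornerE expr1n subrr.
Qed.

Let U0 : U`_0 = 0.
Proof. by rewrite -horner_coef0 horner_comp !hornerE. Qed.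

Let V1 : V`_1 != 0.
Proof.
have -> : V`_1 = V^`()`_0 by rewrite coef_deriv mulr1n.
rewrite -horner_coef0 deriv_comp !derivE !hornerE horner_comp !hornerE.
by rewrite ?hornerMn ?hornerE expr1n pnatr_eq0 -lt0n.
Qed.

Lemma Kseq_exists : exists K, is_Kseq p K.
Proof.
exists (fun n => (-1) ^ (n%:Z - 1) * psdiv (fun i => U`_i) (fun i => V`_i) n).
split; first by rewrite monic_neq0 // monicXnsubC.
move=> n; rewrite -(psdivP U0 V0 V1 n); apply: eq_bigr => i _.
by rewrite mulrA -expfzMl mulrNN mulr1 exp1rz mul1r.
Qed.

Lemma Kseq_unique K K' : is_Kseq p K -> is_Kseq p K' -> K =1 K'.
Proof.
move=> [_ hK] [_ hK'] n.
have /(_ n) := psdiv_uniq (c := fun n => (-1) ^ (n%:Z - 1) * K n)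
  (d := fun n => (-1) ^ (n%:Z - 1) * K' n) V0 V1 hK hK'.
by apply: mulfI; rewrite expfz_neq0 // oppr_eq0 oner_eq0.
Qed.

End KExists.

(* Main.v *)
(* At a primitive p-th root of unity z, put x_k = z^k / (1 - z^k)^2.  Up to the
   factors 1 - z, the entries 2 and 3 contribute x_k and
   y_k = z^(2k) / (1 - z^k)^3, with x_(p-k) = x_k and y_k + y_(p-k) = - x_k.
   Reversing the index tuple through k |-> p - k hence turns the two symmetric
   sums into - (1 - z)^(2t+1) e_t(x) and - (1 - z)^(2t+1) h_t(x).
   With u = (w - 1)^2 / w one has
     p^2 prod_k (1 - u x_k) = (w^p - 2 + w^-p) / u,
   an explicit Chebyshev-like polynomial in u, which gives e_t.  For the inverse
   series, let S = p (w - 1) / (w^p - 1) be the generating series of the K_n(p);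
   then sum_s h_s u^s = S - (w - 1) S', and h_t is the coefficient of
   (w - 1)^(2t) in w^t (S - (w - 1) S'), because w^t u^s = w^(t-s) (w - 1)^(2s)
   has degree t + s < 2t for s < t. *)
Require Import Defs.
From mathcomp Require Import all_boot all_order all_algebra all_field.
From mathcomp Require Import ring zify.
Set Implicit Arguments.
Unset Strict Implicit.
Unset Printing Implicit Defensive.
Import Order.TTheory GRing.Theory Num.Theory.
Local Open Scope ring_scope.

(** * Evaluation of rational functions at a root of unity *)

Definition evalC (z : algC) (u : {poly rat}) : algC := (map_poly ratr u).[z].

Lemma evalCD z u v : evalC z (u + v) = evalC z u + evalC z v.
Proof. by rewrite /evalC rmorphD hornerD. Qed.

Lemma evalCM z u v : evalC z (u * v) = evalC z u * evalC z v.
Proof. by rewrite /evalC rmorphM hornerM. Qed.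

Lemma evalCX z n : evalC z 'X^n = z ^+ n.
Proof. by rewrite /evalC map_polyXn hornerXn. Qed.

Lemma evalCC z c : evalC z c%:P = ratr c.
Proof. by rewrite /evalC map_polyC hornerC. Qed.

Lemma evalC_qnum z n : evalC z (qnum n) = \sum_(i < n) z ^+ i.
Proof.
rewrite /evalC rmorph_sum horner_sum; apply: eq_bigr => i _.
exact: evalCX.
Qed.

Lemma evalC_neq0 z u : evalC z u != 0 -> u != 0.
Proof. by apply: contraNneq => ->; rewrite evalCC rmorph0. Qed.

(* [r] is regular at [z], with value [c]. *)
Definition evalr (z : algC) (r : ratfun) (c : algC) : Prop :=
  exists u v : {poly rat},
    [/\ evalC z v != 0, r = tofrac u / tofrac v & c = evalC z u / evalC z v].

Lemma evalr_poly z u : evalr z (tofrac u) (evalC z u).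
Proof.
have e1 : evalC z 1 = 1 by rewrite -[1]/(1%:P) evalCC rmorph1.
by exists u, 1; rewrite e1 tofrac1 !divr1 oner_neq0.
Qed.

Lemma evalrD z r s c d : evalr z r c -> evalr z s d -> evalr z (r + s) (c + d).
Proof.
move=> [u [v [nv -> ->]]] [u' [v' [nv' -> ->]]].
exists (u * v' + u' * v), (v * v'); rewrite !(tofracD, tofracM, evalCD, evalCM).
by rewrite mulf_neq0 // !addf_div // tofrac_eq0 ?(evalC_neq0 nv) ?(evalC_neq0 nv').
Qed.

Lemma evalrM z r s c d : evalr z r c -> evalr z s d -> evalr z (r * s) (c * d).
Proof.
move=> [u [v [nv -> ->]]] [u' [v' [nv' -> ->]]].
by exists (u * u'), (v * v'); rewrite !(tofracM, evalCM) mulf_neq0 // !mulf_div.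
Qed.

Lemma evalrV z r c : c != 0 -> evalr z r c -> evalr z r^-1 c^-1.
Proof.
move=> nc [u [v [nv -> Dc]]]; exists v, u; rewrite Dc !invf_div; split=> //.
by move: nc; rewrite Dc mulf_eq0 negb_or => /andP[].
Qed.

Lemma evalr_const z c : evalr z (ratconst c) (ratr c).
Proof. by rewrite -(evalCC z); apply: evalr_poly. Qed.

Lemma evalr_int z m : evalr z m%:~R m%:~R.
Proof.
have -> : (m%:~R : ratfun) = ratconst m%:~R by rewrite /ratconst !rmorph_int.
by rewrite -[m%:~R in X in evalr _ _ X](ratr_int algC); apply: evalr_const.
Qed.

Lemma evalrN z r c : evalr z r c -> evalr z (- r) (- c).
Proof.
by move=> rc; rewrite -mulN1r -[- c]mulN1r; apply: evalrM => //; apply: (evalr_int z (-1)).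
Qed.

Lemma evalrX z r c n : evalr z r c -> evalr z (r ^+ n) (c ^+ n).
Proof.
move=> rc; elim: n => [|n IH]; first exact: (evalr_int z 1).
by rewrite !exprS; apply: evalrM.
Qed.

Lemma evalr_sum z (I : finType) (P : pred I) r c :
  (forall i, P i -> evalr z (r i) (c i)) ->
  evalr z (\sum_(i | P i) r i) (\sum_(i | P i) c i).
Proof.
move=> rc; apply: (big_ind2 (evalr z)) => //; first exact: (evalr_int z 0).
by move=> *; apply: evalrD.
Qed.

Lemma evalr_prod z (I : finType) r c :
  (forall i : I, evalr z (r i) (c i)) ->
  evalr z (\prod_i r i) (\prod_i c i).
Proof.
move=> rc; apply: (big_ind2 (evalr z)) => //; first exact: (evalr_int z 1).
by move=> *; apply: evalrM.
Qed.

Lemma evalr_ratq z : evalr z ratq z.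
Proof. by have := evalr_poly z 'X^1; rewrite evalCX. Qed.

(** * Divisibility by the cyclotomic polynomial, tested at a root of unity *)

Section RootOfUnity.
Variables (p : nat) (z : algC).
Hypotheses (p_pr : prime p) (z_prim : p.-primitive_root z).

Lemma prod_subXz : \prod_(1 <= k < p) ('X - (z ^+ k)%:P) = \sum_(i < p) 'X^i.
Proof.
have nz : ('X - 1 : {poly algC}) != 0 by rewrite -polyC1 polyXsubC_eq0.
apply: (mulfI nz); rewrite -subrX1 -(factor_Xn_sub_1 z_prim).
by rewrite [RHS]big_ltn ?prime_gt0 // expr0 polyC1.
Qed.

Lemma minCpoly_qnum : minCpoly z = map_poly ratr (qnum p).
Proof.
rewrite (minCpoly_cyclotomic z_prim) /cyclotomic /qnum rmorph_sum.
under [RHS]eq_bigr do rewrite rmorphXn /= map_polyX.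
rewrite -prod_subXz big_mkcond -(big_mkord xpredT (fun k =>
  if coprime k p then 'X - (z ^+ k)%:P else 1)) big_ltn ?prime_gt0 //.
rewrite /coprime gcd0n gtn_eqF ?prime_gt1 //= mul1r.
apply: eq_big_nat => k /andP[k_gt0 lt_kp].
have := prime_coprime k p_pr; rewrite coprime_sym /coprime => ->.
by rewrite gtnNdvd.
Qed.

Lemma root_qnum u : (evalC z u == 0) = (qnum p %| u).
Proof.
have [m [Dm _ Pm]] := minCpolyP z.
rewrite -[evalC z u == 0]/(root _ _) Pm; congr (_ %| _).
by apply: (map_poly_inj (ratr : {rmorphism rat -> algC})); rewrite -Dm minCpoly_qnum.
Qed.

(** By [root_qnum] the polynomial [qnum p] is prime: being e times its gcd with [v], it divides e or
    that gcd. In the first case degrees make the gcd constant; in the second [v] would vanish at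
    [z]. *)
Lemma coprime_qnum v : evalC z v != 0 -> coprimep v (qnum p).
Proof.
move=> nv; have /dvdpP[e De] := dvdp_gcdr v (qnum p).
have qnz : qnum p != 0.
  by rewrite -(map_poly_eq0 (ratr : rat -> algC)) -minCpoly_qnum minCpoly_eq0.
have : evalC z (e * gcdp v (qnum p)) == 0 by rewrite -De root_qnum.
rewrite evalCM mulf_eq0 !root_qnum => /orP[qe|].
  move: qnz; rewrite {1}De mulf_eq0 negb_or => /andP[enz gnz].
  have := dvdp_leq enz qe; rewrite {1}De size_mul //.
  rewrite coprimep_def.
  move: enz gnz; rewrite -!size_poly_gt0; lia.
move=> qg; have := dvdp_trans qg (dvdp_gcdl _ _).
by rewrite -root_qnum (negPf nv).
Qed.

(** Reduces a congruence to an equality of values at [z]: the numerator of the difference vanishes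
    there, its denominator does not. *)
Lemma eqmod_evalr A B c : evalr z A c -> evalr z B c -> ratfun_eqmod p A B.
Proof.
move=> Ac Bc; have := evalrD Ac (evalrN Bc); rewrite subrr => -[u [v [nv D /esym/eqP]]].
rewrite mulf_eq0 invr_eq0 (negPf nv) orbF => u0.
have [f [a na Du]] := rat_poly_scale u; have [g [b nb Dv]] := rat_poly_scale v.
have naq : (a%:~R : rat) != 0 by rewrite intr_eq0.
have nbq : (b%:~R : rat) != 0 by rewrite intr_eq0.
have Df : map_poly intr f = a%:~R *: u by rewrite Du scalerA divff ?scale1r.
have Dg : map_poly intr g = b%:~R *: v by rewrite Dv scalerA divff ?scale1r.
(* The cross factors restore the quotient u / v after the denominators of [u] and [v] have been
   cleared by [a] and [b]. *)
exists (b *: f), (a *: g); rewrite D !linearZ /= Df Dg !scalerA -!intrM (mulrC b).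
have nab : ((a * b)%:~R : rat) != 0 by rewrite intrM mulf_neq0.
split; first by rewrite coprimepZl // coprime_qnum.
  by rewrite dvdpZr // -root_qnum.
rewrite -!mul_polyC !tofracM invfM mulrACA divff ?mul1r //.
by rewrite tofrac_eq0 polyC_eq0.
Qed.

End RootOfUnity.

(** * Iterated sums over increasing tuples *)

Section ChainSums.
Variable R : comNzRingType.
Implicit Types f : nat -> nat -> R.

(** The summand depends on the position too, so that one position can carry the exponent 3. *)
Definition chain (r : rel nat) n l f : R :=
  \sum_(k : l.-tuple 'I_n.+1 |
          all (fun x : 'I_n.+1 => 0 < x)%N k && sorted r [seq val x | x <- k])
    \prod_(i < l) f i (tnth k i).

Lemma chain_rev (r : rel nat) n l f :
  (forall x y, (0 < x <= n)%N -> (0 < y <= n)%N ->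
     r (n.+1 - y)%N (n.+1 - x)%N = r x y) ->
  chain r n l f = chain r n l (fun i k => f (l.-1 - i)%N (n.+1 - k)%N).
Proof.
move=> rP; pose rho (k : l.-tuple 'I_n.+1) := [tuple of rev (map -%R k)].
(* The opposite in the cyclic group ['I_n.+1] is the reflection n+1-x for x > 0, and it fixes 0. *)
have opp_val (x : 'I_n.+1) : (0 < x)%N -> val (- x) = (n.+1 - x)%N.
  by move=> x_gt0 /=; rewrite modn_small //; have := ltn_ord x; lia.
have opp_gt0 (x : 'I_n.+1) : (0 < val (- x)%R)%N = (0 < x)%N.
  case: (posnP x) => [x0|x_gt0]; first by rewrite /= x0 subn0 modnn.
  by rewrite opp_val //; have := ltn_ord x; lia.
have rhoK : involutive rho.
  move=> k; apply: val_inj; rewrite /= map_rev revK -map_comp.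
  by rewrite map_id_in // => x _ /=; rewrite opprK.
have rho_pos k : all (fun x : 'I_n.+1 => 0 < x)%N (rho k) = all (fun x : 'I_n.+1 => 0 < x)%N k.
  by rewrite all_rev all_map; apply: eq_all => x; apply: opp_gt0.
rewrite /chain (reindex_inj (inv_inj rhoK)); apply: eq_big => [k|k /andP[kpos _]].
  rewrite rho_pos; apply: andb_id2l => kpos.
  rewrite map_rev rev_sorted -map_comp !sorted_map.
  apply: (eq_in_sorted (P := fun x : 'I_n.+1 => 0 < x)%N) => // x y x_gt0 y_gt0.
  have xn := ltn_ord x; have yn := ltn_ord y.
  rewrite [LHS]/= -/(val (- x)) -/(val (- y)).
  by rewrite /= !modn_small ?rP; try lia.
rewrite (reindex_inj rev_ord_inj); apply: eq_bigr => i _.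
have lt_il := ltn_ord i; have ipos : (0 < tnth k i)%N.
  by move: kpos; rewrite rho_pos => /all_tnthP.
have -> : tnth (rho k) (rev_ord i) = - tnth k i.
  rewrite !(tnth_nth ord0) /= nth_rev size_map size_tuple; last by lia.
  by rewrite subnS subKn // (nth_map ord0) // size_tuple.
by rewrite opp_val //=; congr (f _ _); lia.
Qed.

(** Reversing the second sum moves its [y] from position [b] to position [a]. For each tuple the two
    products then differ in one factor only, and these factors add up to c x_k. *)
Lemma chain_sym_add (r : rel nat) n a b l (x y : nat -> R) c :
  (forall x y, (0 < x <= n)%N -> (0 < y <= n)%N ->
     r (n.+1 - y)%N (n.+1 - x)%N = r x y) ->
  l = (a + b + 1)%N ->
  (forall k, (0 < k <= n)%N -> x (n.+1 - k)%N = x k) ->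
  (forall k, (0 < k <= n)%N -> y k + y (n.+1 - k)%N = c * x k) ->
  chain r n l (fun i => if i == a then y else x)
    + chain r n l (fun i => if i == b then y else x)
  = c * chain r n l (fun=> x).
Proof.
move=> rP Dl xP yP; rewrite [X in _ + X](chain_rev _ _ rP) /chain mulr_sumr -big_split.
apply: eq_bigr => k /andP[kpos _].
have kP (i : 'I_l) : (0 < tnth k i <= n)%N.
  by rewrite (all_tnthP kpos) -ltnS ltn_ord.
have lt_al : (a < l)%N by lia.
pose i0 := Ordinal lt_al.
rewrite (bigD1 i0) //= [X in _ + X](bigD1 i0) //= [X in c * X](bigD1 i0) //= eqxx.
have -> : (l.-1 - a == b)%N by apply/eqP; lia.
rewrite mulrA -yP // mulrDl; congr (_ * _ + _ * _).
  by apply: eq_bigr => i; rewrite -val_eqE /= => /negPf->.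
apply: eq_bigr => i; rewrite -val_eqE /= => nia.
have -> : (l.-1 - i == b)%N = false by apply/eqP; have := ltn_ord i; lia.
exact: xP.
Qed.

(** The bound [lo] gives a recursion: the first entry becomes the bound for the rest. The values 0
    for [ltn] and 1 for [leq] express positivity. *)
Definition psum (r : rel nat) N l lo (x : nat -> R) : R :=
  \sum_(k : l.-tuple 'I_N | path r lo [seq val m | m <- k])
    \prod_(i < l) x (tnth k i).

Lemma chain_psum_ltn n l (x : nat -> R) : chain ltn n l (fun=> x) = psum ltn n.+1 l 0 x.
Proof.
apply: eq_bigl => k; rewrite path_sortedE; last exact: ltn_trans.
by rewrite all_map.
Qed.

Lemma chain_psum_leq n l (x : nat -> R) : chain leq n l (fun=> x) = psum leq n.+1 l 1 x.
Proof.
apply: eq_bigl => k; rewrite path_sortedE; last exact: leq_trans.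
by rewrite all_map.
Qed.

Lemma psum0 r N lo (x : nat -> R) : psum r N 0 lo x = 1.
Proof.
rewrite /psum (big_pred1 [tuple]) ?big_ord0 // => k.
by rewrite tuple0 /= eqxx.
Qed.

Lemma psumS r N l lo (x : nat -> R) :
  psum r N l.+1 lo x = \sum_(m < N | r lo m) x m * psum r N l m x.
Proof.
rewrite /psum (reindex (fun mk : 'I_N * l.-tuple 'I_N => [tuple of mk.1 :: mk.2])) /=; last first.
  exists (fun k => (thead k, [tuple of behead k])) => [[m k] _|k _] /=.
    by congr (_, _); apply: val_inj.
  by rewrite -tuple_eta.
under [RHS]eq_bigr do rewrite mulr_sumr.
rewrite pair_big_dep; apply: eq_bigr => -[m k] _ /=.
rewrite big_ord_recl tnth0; congr (_ * _); apply: eq_bigr => i _.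
by rewrite tnthS.
Qed.

(** The first entry is either lo+1 or larger, which matches expanding the first factor: these sums
    are elementary symmetric polynomials. *)
Lemma psum_ltn N l lo (x : nat -> R) : (lo < N)%N ->
  psum ltn N l lo x = (\prod_(lo.+1 <= m < N) (1 + x m *: 'X))`_l.
Proof.
move Dd: (N - lo.+1)%N => d; elim: d => [|d IH] in l lo Dd * => lt_loN.
  rewrite big_geq ?coef1; last by lia.
  case: l => [|l]; first by rewrite psum0.
  by rewrite psumS big_pred0 // => m; apply/negbTE; have := ltn_ord m; rewrite /=; lia.
have lt_loN' : (lo.+1 < N)%N by lia.
rewrite big_ltn // mulrDl mul1r -scalerAl coefD coefZ coefXM.
case: l => [|l]; first by rewrite mulr0 addr0 -IH ?psum0 //; lia.
rewrite -!IH ?[psum ltn N l.+1 _ _]psumS //; try lia.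
rewrite (bigD1 (Ordinal lt_loN')) //= addrC; congr (_ + _).
by apply: eq_bigl => m; rewrite -val_eqE /=; lia.
Qed.

(** Multiplying by 1 - x_lo X discards the tuples that start with lo, so the factors are absorbed
    one by one. The sums are complete homogeneous polynomials, with generating series cut at order
    [M]. *)
Lemma psum_leq N M lo (x : nat -> R) : (lo <= N)%N ->
  forall i, (i < M)%N ->
  (\prod_(lo <= m < N) (1 - x m *: 'X) * \poly_(l < M) psum leq N l lo x)`_i
    = (i == 0%N)%:R.
Proof.
move Dd: (N - lo)%N => d; elim: d => [|d IH] in lo Dd * => le_loN i lt_iM.
  rewrite big_geq ?mul1r ?coef_poly ?lt_iM; last by lia.
  case: i lt_iM => [|i] _; first by rewrite psum0.
  by rewrite psumS big_pred0 // => m; apply/negbTE; have := ltn_ord m; lia.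
have lt_loN : (lo < N)%N by lia.
rewrite big_ltn // mulrAC mulrC -[RHS](IH lo.+1) //; try lia.
rewrite !coefM; apply: eq_bigr => j _; congr (_ * _).
move: (i - j)%N (leq_ltn_trans (leq_subr j i) lt_iM) => l lt_lM.
rewrite mulrBl mul1r -scalerAl coefB coefZ coefXM !coef_poly lt_lM.
case: l lt_lM => [|l] lt_lM; first by rewrite mulr0 subr0 !psum0.
rewrite (ltnW lt_lM) /= ![psum _ _ l.+1 _ _]psumS (bigD1 (Ordinal lt_loN)) //=.
by rewrite addrC addrK; apply: eq_bigl => m; rewrite -val_eqE /=; lia.
Qed.

End ChainSums.

Lemma chain_ext (R : comNzRingType) (r : rel nat) n l (f g : nat -> nat -> R) :
  (forall i, (i < l)%N -> f i =1 g i) -> chain r n l f = chain r n l g.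
Proof. by move=> fg; apply: eq_bigr => k _; apply: eq_bigr => i _; apply: fg. Qed.

Lemma psumZ (R : comNzRingType) (r : rel nat) N l lo (c : R) (x : nat -> R) :
  psum r N l lo (fun k => c * x k) = c ^+ l * psum r N l lo x.
Proof.
rewrite /psum mulr_sumr; apply: eq_bigr => k _.
by rewrite big_split prodr_const card_ord.
Qed.

(** * Chebyshev-type coefficients *)

(** The coefficient of u^(s+1) in 2 T_n(1 + u/2) - 2, with T_n the Chebyshev polynomial of the first
    kind. *)
Definition chebc (n s : nat) : nat := 'C(n + s + 1, 2 * s + 2) + 'C(n + s, 2 * s + 2).

Lemma chebc_small n s : (n <= s)%N -> chebc n s = 0%N.
Proof. by move=> le_ns; rewrite /chebc !bin_small //; lia. Qed.

(** Together with [chebc_rec], the coefficientwise form of W_{n+2} = (2 + u) W_{n+1} - W_n + 2u for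
    W_n = z^n - 2 + z^-n; the term 2u shows only here. *)
Lemma chebc0_rec n : (chebc n.+2 0 + chebc n 0 = 2 * chebc n.+1 0 + 2)%N.
Proof.
rewrite /chebc !muln0 !add0n !addn0 !addn1 !binS !bin0 !bin1; lia.
Qed.

Lemma chebc_rec n s :
  (chebc n.+2 s.+1 + chebc n s.+1 = chebc n.+1 s + 2 * chebc n.+1 s.+1)%N.
Proof.
rewrite /chebc.
have -> : (n.+2 + s.+1 + 1 = (n + s).+4)%N by lia.
have -> : (n.+2 + s.+1 = (n + s).+3)%N by lia.
have -> : (n + s.+1 + 1 = (n + s).+2)%N by lia.
have -> : (n + s.+1 = (n + s).+1)%N by lia.
have -> : (n.+1 + s + 1 = (n + s).+2)%N by lia.
have -> : (n.+1 + s = (n + s).+1)%N by lia.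
have -> : (n.+1 + s.+1 + 1 = (n + s).+3)%N by lia.
have -> : (n.+1 + s.+1 = (n + s).+2)%N by lia.
have -> : (2 * s.+1 + 2 = (2 * s).+4)%N by lia.
have -> : (2 * s + 2 = (2 * s).+2)%N by lia.
rewrite !binS; lia.
Qed.

(** Pascal's rule and (k+1) C(n, k+1) = (n-k) C(n, k) bring the coefficient into the binomial form
    of the theorem. *)
Lemma chebc_bin p t : (t < p)%N -> (chebc p t * t.+1 = p * 'C(p + t, 2 * t + 1))%N.
Proof.
move=> lt_tp; have := mul_bin_left (p + t) (2 * t + 1).
have -> : (p + t - (2 * t + 1) = p - t - 1)%N by lia.
have e1 : (2 * t + 2 = (2 * t + 1).+1)%N by lia.
rewrite /chebc e1 (addn1 (p + t)) binS.
move: 'C(p + t, (2 * t + 1).+1) 'C(p + t, 2 * t + 1) => B2 B1.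
have [d ->] : exists d, p = (t + 1 + d)%N by exists (p - t - 1)%N; lia.
have -> : (t + 1 + d - t - 1 = d)%N by lia.
nia.
Qed.

(* Terms with [s >= n], where [n.-1 - s] is truncated, vanish by [chebc_small].
   With u = (z - 1)^2 / z, the left-hand side is z^n u (sum_s c_s u^s), and
   z^n - 2 + z^-n satisfies W_{n+2} = (2 + u) W_{n+1} - W_n + 2 u. *)
Lemma chebc_sum (R : comNzRingType) (z : R) n M : (n <= M)%N ->
  \sum_(s < M) (chebc n s)%:R * ((z - 1) ^+ (2 * s + 2) * z ^+ (n.-1 - s))
    = (z ^+ n - 1) ^+ 2.
Proof.
pose T n s := (chebc n s)%:R * ((z - 1) ^+ (2 * s + 2) * z ^+ (n.-1 - s)).
(* The recurrence has order two, so the induction carries [n] and [n.+1] together, with a fixed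
   number of terms. *)
suff sumT M' : forall n, (n <= M'.+1)%N ->
    \sum_(s < M'.+1) T n s = (z ^+ n - 1) ^+ 2 /\
    ((n < M'.+1)%N -> \sum_(s < M'.+1) T n.+1 s = (z ^+ n.+1 - 1) ^+ 2).
  case: M => [|M]; last by move=> /sumT[].
  by rewrite leqn0 big_ord0 => /eqP->; rewrite expr0 subrr expr0n.
elim=> {n M} [_|n IH lt_nM].
  split.
    rewrite big1 ?expr0 ?subrr ?expr0n // => s _.
    by rewrite /T chebc_small // mul0r.
  move=> _; rewrite big_ord_recl big1 ?addr0 => [|s _].
    by rewrite /T /= muln0 expr0 mulr1 mul1r expr1.
  by rewrite /T chebc_small // mul0r.
have [e0 /(_ lt_nM) e1] := IH (ltnW lt_nM); split=> // lt_nM'.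
have TS s : T n.+2 s.+1 = (z - 1) ^+ 2 * T n.+1 s + 2%:R * z * T n.+1 s.+1 - z ^+ 2 * T n s.+1.
  rewrite /T; have := congr1 (fun k => k%:R : R) (chebc_rec n s).
  rewrite natrD [in RHS]natrD natrM => /(canRL (addrK _)) ->.
  have -> : (2 * s.+1 + 2 = (2 * s + 2) + 2)%N by lia.
  rewrite exprD /=; have -> : (n.+1 - s.+1 = n - s)%N by lia.
  have [lt_sn|le_ns] := ltnP s.+1 n.
    have [k ->] : exists k, n = (s + 2 + k)%N by exists (n - s - 2)%N; lia.
    have -> : (s + 2 + k - s = k.+2)%N by lia.
    have -> : (s + 2 + k - s.+1 = k.+1)%N by lia.
    have -> : ((s + 2 + k).-1 - s.+1 = k)%N by lia.
    by rewrite !exprS; ring.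
  rewrite [chebc n s.+1]chebc_small //.
  have [lt_sn|le_ns'] := ltnP s n.
    have -> : (n - s = 1)%N by lia.
    have -> : (n - s.+1 = 0)%N by lia.
    by rewrite expr0; ring.
  rewrite [chebc n.+1 s.+1]chebc_small //; ring.
have T0 : T n.+2 0 = 2%:R * z * T n.+1 0 - z ^+ 2 * T n 0 + 2%:R * (z - 1) ^+ 2 * z ^+ n.+1.
  rewrite /T; have := congr1 (fun k => k%:R : R) (chebc0_rec n).
  rewrite natrD [in RHS]natrD natrM => /(canRL (addrK _)) ->.
  rewrite muln0 !subn0 /=.
  case: n {IH e0 e1 lt_nM lt_nM' TS} => [|n]; last by rewrite !exprS; ring.
  by rewrite [chebc 0 0]chebc_small //; ring.
(* The last term vanishes, so the sum shifted by one index is still complete. *)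
have TM : T n.+1 M' = 0 by rewrite /T chebc_small ?mul0r.
have e1' : \sum_(s < M') T n.+1 s = (z ^+ n.+1 - 1) ^+ 2.
  by rewrite -e1 big_ord_recr /= TM addr0.
have sumS k : \sum_(s < M'.+1) T k s = T k 0%N + \sum_(s < M') T k s.+1.
  by rewrite big_ord_recl; congr (_ + _); apply: eq_bigr => s _; rewrite lift0.
move: e0 e1; rewrite !sumS T0 => /(canRL (addKr _)) e0 /(canRL (addKr _)) e2.
under eq_bigr do rewrite TS.
rewrite sumrB big_split -!mulr_sumr /= e1' e0 e2 !exprS /=; ring.
Qed.

(** * The product of the factors 1 - u x_k *)

Section ProductFormula.
Variables (p : nat) (z : algC).
Hypotheses (p_pr : prime p) (z_prim : p.-primitive_root z).

Definition xval (k : nat) : algC := z ^+ k / (1 - z ^+ k) ^+ 2.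

Lemma sub1z_neq0 k : (0 < k < p)%N -> 1 - z ^+ k != 0.
Proof.
case/andP=> k_gt0 lt_kp; rewrite subr_eq0 eq_sym -(prim_order_dvd z_prim).
by rewrite gtnNdvd.
Qed.

Lemma prod_sub_prim (w : algC) : \prod_(1 <= k < p) (w - z ^+ k) = \sum_(i < p) w ^+ i.
Proof.
have := congr1 (horner^~ w) (prod_subXz p_pr z_prim).
rewrite horner_prod horner_sum; under eq_bigr do rewrite hornerXsubC.
by move=> ->; apply: eq_bigr => i _; rewrite hornerXn.
Qed.

(** The polynomial 1 + w + ... + w^(p-1) is palindromic, so [prod_sub_prim] at 1/w gives it
    again. *)
Lemma prod_1sub_prim (w : algC) : w != 0 ->
  \prod_(1 <= k < p) (1 - w * z ^+ k) = \sum_(i < p) w ^+ i.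
Proof.
move=> nw; rewrite (eq_bigr (fun k => w * (w^-1 - z ^+ k))) => [|k _]; last first.
  by rewrite mulrBr divff.
rewrite big_split /= prod_sub_prim prodr_const_nat mulr_sumr.
rewrite (reindex_inj rev_ord_inj); apply: eq_bigr => i _ /=.
have lt_ip := ltn_ord i.
rewrite exprVn; apply: (mulIf (expf_neq0 (p - i.+1) nw)).
rewrite divfK ?expf_neq0 // -exprD; congr (_ ^+ _); lia.
Qed.

Lemma prod_xval_chebc :
  p%:R ^+ 2 *: \prod_(1 <= k < p) (1 - xval k *: 'X) = \poly_(s < p) (chebc p s)%:R.
Proof.
have p_gt0 := prime_gt0 p_pr.
apply/eqP; rewrite -subr_eq0; set D := _ - _; apply/eqP.
suff D0 (u : algC) : u != 0 -> root D u.
  (* The points 1, ..., [size D] are more roots than a nonzero [D] can have. *)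
  apply: (@roots_geq_poly_eq0 _ _ [seq i.+1%:R | i <- iota 0 (size D)]).
  - by apply/allP=> _ /mapP[i _ ->]; apply: D0; rewrite pnatr_eq0.
  - by rewrite map_inj_uniq ?iota_uniq // => i j /eqP; rewrite eqr_nat => /eqP[].
  - by rewrite size_map size_iota.
move=> nu; have [w Dw] : exists w : algC, (w - 1) ^+ 2 = u * w.
  (* A root of w^2 - 2aw + 1 with a = 1 + u/2. *)
  exists (1 + u / 2%:R + sqrtC ((1 + u / 2%:R) ^+ 2 - 1)).
  set a := 1 + _; set b := sqrtC _.
  have Db : b ^+ 2 = a ^+ 2 - 1 by rewrite sqrtCK.
  have Du : u = 2%:R * (a - 1) by rewrite /a; field.
  by rewrite Du; ring: Db.
have nw : w != 0.
  apply: contraTneq (oner_neq0 algC) => w0.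
  by rewrite w0 mulr0 sub0r sqrrN expr1n in Dw; rewrite Dw eqxx.
have nw1 : w - 1 != 0 by rewrite -sqrf_eq0 Dw mulf_neq0.
rewrite /root /D hornerD hornerN hornerZ horner_prod horner_poly subr_eq0.
under eq_bigr do rewrite !hornerE.
have nwX : (w - 1) ^+ 2 * w ^+ p.-1 != 0 by rewrite !(mulf_neq0, expf_neq0).
apply/eqP/(mulfI nwX); transitivity ((w ^+ p - 1) ^+ 2).
  rewrite subrX1 exprMn -mulrA; congr (_ * _).
  have p1 : p%:R = \prod_(1 <= k < p) (1 - z ^+ k).
    rewrite prod_sub_prim; under eq_bigr do rewrite expr1n.
    by rewrite sumr_const card_ord.
  have -> : w ^+ p.-1 = \prod_(1 <= k < p) w by rewrite prodr_const_nat subn1.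
  rewrite p1 -prodrXl -!big_split /= expr2.
  rewrite -{1}(prod_1sub_prim nw) -prod_sub_prim -big_split /=.
  apply: eq_big_nat => k kp; have nk := sub1z_neq0 kp.
  rewrite /xval; set y := z ^+ k in nk *.
  (* With u w = (w-1)^2 the factor becomes w (1-y)^2 - y (w-1)^2 = (w - y)(1 - w y). *)
  have -> : w * ((1 - y) ^+ 2 * (1 - y / (1 - y) ^+ 2 * u)) = w * (1 - y) ^+ 2 - y * (u * w).
    by field.
  by rewrite -Dw; ring.
rewrite -(chebc_sum w (leqnn p)) mulr_sumr; apply: eq_bigr => s _.
have lt_sp := ltn_ord s.
rewrite exprD (_ : p.-1 = s + (p.-1 - s))%N; last by lia.
rewrite addKn exprD exprM Dw exprMn; ring.
Qed.

End ProductFormula.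

(** * Power series modulo a power of the variable *)

Section ModXn.
Variable F : fieldType.
Implicit Types A B : {poly F}.

(** Congruence modulo 'X^n replaces equality of power series up to that order. *)
Definition eqX n A B := 'X^n %| A - B.

Lemma eqX_refl n A : eqX n A A.
Proof. by rewrite /eqX subrr dvdp0. Qed.

Lemma eqX_sym n A B : eqX n A B -> eqX n B A.
Proof. by rewrite /eqX -dvdpNr opprB. Qed.

Lemma eqX_trans n A B D : eqX n A B -> eqX n B D -> eqX n A D.
Proof. by rewrite /eqX => AB BD; rewrite -(subrKA B) dvdp_add. Qed.

Lemma eqXM n A B A' B' : eqX n A B -> eqX n A' B' -> eqX n (A * A') (B * B').
Proof.
rewrite /eqX => AB AB'.
have -> : A * A' - B * B' = (A - B) * A' + B * (A' - B') by ring.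
by rewrite dvdp_add // ?(dvdp_mulr _ AB) ?(dvdp_mull _ AB').
Qed.

Lemma eqXX n A B m : eqX n A B -> eqX n (A ^+ m) (B ^+ m).
Proof.
by move=> AB; elim: m => [|m IH]; rewrite ?expr0 ?eqX_refl // !exprS eqXM.
Qed.

Lemma eqX_sum n (I : finType) (A B : I -> {poly F}) :
  (forall i, eqX n (A i) (B i)) -> eqX n (\sum_i A i) (\sum_i B i).
Proof.
move=> AB; apply: (big_ind2 (eqX n)) => // [|A1 B1 A2 B2]; first exact: eqX_refl.
by rewrite /eqX opprD addrACA => AB1 AB2; rewrite dvdp_add.
Qed.

Lemma eqXP n A B : reflect (forall i, (i < n)%N -> A`_i = B`_i) (eqX n A B).
Proof.
apply: (iffP idP) => [/dvdpP[D DAB] i lt_in|eqAB].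
  by apply/eqP; rewrite -subr_eq0 -coefB DAB coefMXn lt_in.
rewrite /eqX -(poly_take_drop n (A - B)) dvdp_add ?dvdp_mulIr //.
rewrite (_ : take_poly n _ = 0) ?dvdp0 //; apply/polyP => i.
by rewrite coef_take_poly coef0 coefB; case: ltnP => // /eqAB->; rewrite subrr.
Qed.

Lemma eqX_cancel n (D : {poly F}) A B : D`_0 != 0 -> eqX n (D * A) (D * B) -> eqX n A B.
Proof.
move=> D0; rewrite /eqX -mulrBr Gauss_dvdpr // coprimep_expl //.
by rewrite coprimep_sym -['X]subr0 -polyC0 coprimep_XsubC /root horner_coef0.
Qed.

(** Differentiation alone would lose one order; the factor 'X restores it. *)
Lemma eqX_Xderiv n A B : eqX n A B -> eqX n ('X * A^`()) ('X * B^`()).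
Proof.
move=> /eqXP AB; apply/eqXP => -[|i] lt_in; rewrite !coefXM //= !coef_deriv.
by rewrite AB.
Qed.

Lemma eqX_divX n A B : eqX n.+1 ('X * A) ('X * B) -> eqX n A B.
Proof.
move=> /eqXP AB; apply/eqXP => i lt_in.
by have := AB i.+1 lt_in; rewrite !coefXM.
Qed.

End ModXn.

(** * Complete homogeneous sums through the series p (w-1) / (w^p - 1) *)

Section Complete.
Variables (F : fieldType) (p t : nat) (f h : nat -> F).
Hypotheses (p_gt0 : (0 < p)%N) (p_neq0 : p%:R != 0 :> F).

(** With 'X = w - 1, [Z] is w, [V1] is (w^p - 1) / (w - 1), and [f] lists the coefficients of p /
    [V1]. *)
Let Z : {poly F} := 1 + 'X.
Let V1 : {poly F} := \sum_(i < p) Z ^+ i.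

Hypothesis fP : forall n,
  \sum_(i < n.+1) (Z ^+ p - 1)`_i * f (n - i)%N = (p%:R *: 'X : {poly F})`_n.
Hypothesis hP : forall i, (i < t.+1)%N ->
  (\poly_(s < p) (chebc p s)%:R * \poly_(l < t.+1) h l)`_i
    = p%:R ^+ 2 * (i == 0%N)%:R.

(** Precision that just reaches the coefficient of 'X^(2t); [S] keeps one more term because [V1S] is
    obtained by cancelling an 'X. *)
Let N := (2 * t + 1)%N.
Let S : {poly F} := \poly_(n < N.+1) f n.

Lemma ZpE : Z ^+ p - 1 = 'X * V1.
Proof. by rewrite subrX1 /Z addrC addKr. Qed.

Lemma V1_0 : V1`_0 = p%:R.
Proof.
rewrite -horner_coef0 horner_sum (eq_bigr (fun=> 1)) => [|i _].
  by rewrite sumr_const card_ord.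
by rewrite !hornerE expr1n.
Qed.

Lemma V1S : eqX N (V1 * S) p%:R%:P.
Proof.
apply: eqX_divX; rewrite mulrA -ZpE; apply/eqXP => i lt_iN.
rewrite [in RHS]mulrC mul_polyC -fP coefM; apply: eq_bigr => j _; rewrite coef_poly.
by rewrite (leq_ltn_trans (leq_subr _ _)).
Qed.

(* [S] is [p / V1] modulo ['X^N], and [p ('X V1)' = p^2 Z^(p-1)]. *)
Lemma V1sqr_eulerS : eqX N (V1 ^+ 2 * (S - 'X * S^`())) ((p%:R ^+ 2)%:P * Z ^+ p.-1).
Proof.
have V1S' : eqX N ('X * (V1 * S)^`()) 0.
  by have := eqX_Xderiv V1S; rewrite derivC mulr0.
have DV : V1 + 'X * V1^`() = p%:R%:P * Z ^+ p.-1.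
  have := congr1 (@deriv F) ZpE; rewrite derivM derivX mul1r => <-.
  rewrite derivB deriv_exp derivD derivX derivC add0r subr0 mul1r.
  by rewrite polyC_natr mulr_natl.
move: V1S V1S'; rewrite /eqX derivM subr0 => d1 d2.
have -> : V1 ^+ 2 * (S - 'X * S^`()) - (p%:R ^+ 2)%:P * Z ^+ p.-1
   = (V1 * S - p%:R%:P) * (V1 + 'X * V1^`()) - V1 * ('X * (V1^`() * S + V1 * S^`())).
  by rewrite [p%:R ^+ 2]expr2 polyCM -[_ * _ * Z ^+ _]mulrA -DV; ring.
by rewrite dvdp_sub ?(dvdp_mulr _ d1) ?(dvdp_mull _ d2).
Qed.

(** A truncated geometric series, inverse to [Z] modulo 'X^N. *)
Let Zi : {poly F} := \sum_(i < N) (- 'X) ^+ i.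

Lemma ZZi : eqX N (Z * Zi) 1.
Proof.
rewrite /eqX (_ : Z * Zi - 1 = - (- 'X) ^+ N); last first.
  by have /(canRL (subrK _)) -> := subrX1 (- 'X : {poly F}) N; rewrite -/Zi /Z; ring.
by rewrite dvdpNr exprNn dvdp_mull.
Qed.

Lemma ZZiX m n : (n <= m)%N -> eqX N (Z ^+ m * Zi ^+ n) (Z ^+ (m - n)).
Proof.
move=> le_nm; rewrite -{1}(subnK le_nm) exprD -mulrA -exprMn -[X in eqX _ _ X]mulr1.
by rewrite eqXM ?eqX_refl // -[X in eqX _ _ X](expr1n _ n) eqXX ?ZZi.
Qed.

(* [U] stands for ['X^2 / (1 + 'X)] modulo ['X^N]. *)
Let U := 'X ^+ 2 * Zi.

(** The factor [Z ^+ m] clears the denominators Z^s of the powers of [U]; the bound on [d] ensures s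
    <= m. *)
Lemma compU d m (c : nat -> F) : (d <= m.+1)%N ->
  eqX N (Z ^+ m * (\poly_(s < d) c s \Po U))
        (\sum_(s < d) (c s)%:P * ('X ^+ (2 * s) * Z ^+ (m - s))).
Proof.
move=> le_dm; rewrite poly_def rmorph_sum /= mulr_sumr; apply: eqX_sum => s.
have lt_sd := ltn_ord s.
rewrite comp_polyZ comp_Xn_poly -mul_polyC mulrCA eqXM ?eqX_refl // /U exprMn -exprM.
by rewrite mulrCA eqXM ?eqX_refl // ZZiX //; lia.
Qed.

(** This is [chebc_sum] at [Z], divided by 'X^2. *)
Lemma V1sqr_comp : eqX N (V1 ^+ 2) (Z ^+ p.-1 * (\poly_(s < p) (chebc p s)%:R \Po U)).
Proof.
apply: eqX_sym; apply: eqX_trans (compU _ _) _; first by rewrite prednK.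
rewrite (_ : \sum_(s < p) _ = V1 ^+ 2) ?eqX_refl //.
have nX : ('X ^+ 2 : {poly F}) != 0 by rewrite expf_neq0 ?polyX_eq0.
apply: (mulfI nX); rewrite -[RHS]exprMn -ZpE -(chebc_sum _ (leqnn p)) mulr_sumr.
have Z1 : Z - 1 = 'X by rewrite /Z addrC addKr.
by apply: eq_bigr => s _; rewrite Z1 exprD polyC_natr; ring.
Qed.

(** As 'X^2 divides [U], substituting [U] turns [hP], valid modulo 'X^(t+1), into a congruence
    modulo 'X^(2t+2), beyond the precision [N]. *)
Lemma V1sqr_h : eqX N (V1 ^+ 2 * (\poly_(l < t.+1) h l \Po U)) ((p%:R ^+ 2)%:P * Z ^+ p.-1).
Proof.
apply: eqX_trans (eqXM V1sqr_comp (eqX_refl _ _)) _.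
rewrite -mulrA mulrC eqXM ?eqX_refl // -comp_polyM.
have : eqX t.+1 (\poly_(s < p) (chebc p s)%:R * \poly_(l < t.+1) h l) (p%:R ^+ 2)%:P.
  by apply/eqXP => i lt_it; rewrite hP // coefC; case: eqP; rewrite ?mulr1 ?mulr0.
move=> /dvdpP[Q /(canRL (subrK _)) ->].
rewrite /eqX rmorphD rmorphM /= comp_polyC comp_Xn_poly addrK.
rewrite dvdp_mull // /U exprMn -exprM dvdp_mulr // dvdp_exp2l //; rewrite /N; lia.
Qed.

Lemma coef_euler n : (n <= N)%N -> (S - 'X * S^`())`_n = (1 - n%:R) * f n.
Proof.
rewrite coefB coefXM coef_deriv coef_poly ltnS => le_nN; rewrite le_nN.
case: n le_nN => [|n] le_nN; first by rewrite /= !subr0 mul1r.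
by rewrite /= coef_poly ltnS le_nN mulrBl mul1r mulr_natl.
Qed.

Lemma coef_expZ m i : (Z ^+ m)`_i = 'C(m, i)%:R.
Proof.
rewrite /Z exprDn (eq_bigr (fun i : 'I_m.+1 => 'C(m, i)%:R *: 'X^i)) => [|j _].
  rewrite -(poly_def _ (fun i => 'C(m, i)%:R)) coef_poly ltnS.
  by case: leqP => // /bin_small->.
by rewrite expr1n mul1r scaler_nat.
Qed.

(** The right-hand sides of [V1sqr_h] and [V1sqr_eulerS] agree, so [V1 ^+ 2] cancels; the
    coefficients of 'X^(2t) are compared after multiplication by [Z ^+ t]. *)
Lemma complete_coef :
  h t = \sum_(i < t.+1) 'C(t, i)%:R * ((1 - (2 * t - i)%:R) * f (2 * t - i)%N).
Proof.
have V0 : (V1 ^+ 2)`_0 != 0 by rewrite expr2 coef0M V1_0 mulf_neq0.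
have := eqX_cancel V0 (eqX_trans V1sqr_h (eqX_sym V1sqr_eulerS)).
move=> /(eqXM (eqX_refl N (Z ^+ t))) E.
have := eqX_trans (eqX_sym (compU _ (leqnn _))) E.
move=> /eqXP /(_ (2 * t)%N); rewrite {1}/N addn1 => /(_ (leqnn _)).
rewrite coef_sum (bigD1 ord_max) //= big1 => [|s ns]; last first.
  have lt_st : (s < t)%N by have := ltn_ord s; move: ns; rewrite -val_eqE /=; lia.
  rewrite coefCM coefXnM coef_expZ bin_small ?if_same ?mulr0 //; lia.
rewrite coefCM coefXnM ltnn subnn coef_expZ subnn bin0 mulr1 addr0 => ->.
rewrite coefM (_ : (2 * t).+1 = t.+1 + t)%N; last by lia.
rewrite big_split_ord /= [X in _ + X]big1 ?addr0 => [|i _]; last first.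
  by rewrite coef_expZ bin_small ?mul0r // addSn ltnS leq_addr.
by apply: eq_bigr => i _; rewrite coef_expZ coef_euler // /N; lia.
Qed.

End Complete.

(** * The sums at a primitive root of unity *)

Section AtRootOfUnity.
Variables (p : nat) (z : algC).
Hypotheses (p_pr : prime p) (z_prim : p.-primitive_root z).

Let p_gt0 := prime_gt0 p_pr.
Let pK : ((p - 1).+1 = p)%N.
Proof. by rewrite subn1 prednK. Qed.

Definition qterm (s k : nat) : algC := z ^+ ((s - 1) * k) * ((1 - z) / (1 - z ^+ k)) ^+ s.

Lemma sub1z : 1 - z != 0.
Proof. by have := @sub1z_neq0 p z z_prim 1 (prime_gt1 p_pr). Qed.

Lemma evalr_qsum (r : rel nat) (s : seq nat) l : size s = l ->
  evalr z (qsum r (p - 1) s) (chain r (p - 1) l (fun i => qterm (nth 0%N s i))).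
Proof.
move=> <-; apply: evalr_sum => k /andP[kpos _]; apply: evalr_prod => i.
have kp : (0 < tnth k i < p)%N by rewrite (all_tnthP kpos) -[X in (_ < X)%N]pK ltn_ord.
have nk := sub1z_neq0 z_prim kp.
apply: evalrM; first exact/evalrX/evalr_ratq.
rewrite -exprVn; apply: evalrX.
have -> : (1 - z) / (1 - z ^+ tnth k i) = (evalC z (qnum (tnth k i)))^-1.
  rewrite evalC_qnum -opprB -[X in _ / X]opprB subrX1 invrN mulrNN invfM mulVKf //.
  by rewrite subr_eq0 eq_sym -subr_eq0 sub1z.
apply: evalrV; last exact: evalr_poly.
apply: contraNneq nk; rewrite evalC_qnum => e0.
by rewrite -opprB subrX1 e0 mulr0 oppr0.
Qed.

Lemma qterm2 k : qterm 2 k = (1 - z) ^+ 2 * xval z k.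
Proof. by rewrite /qterm /xval mul1n expr_div_n mulrCA mulrA. Qed.

(** Since z^(p-k) = 1 / z^k, both are rational identities in y = z^k. *)
Lemma qterm_flip k : (0 < k <= p - 1)%N ->
  qterm 2 ((p - 1).+1 - k) = qterm 2 k /\
  qterm 3 k + qterm 3 ((p - 1).+1 - k) = - (1 - z) * qterm 2 k.
Proof.
move=> kn; have kp : (0 < k < p)%N by rewrite -pK.
have nk := sub1z_neq0 z_prim kp; rewrite pK /qterm.
have zz : z ^+ (p - k) * z ^+ k = 1.
  by rewrite -exprD subnK ?(prim_expr_order z_prim) // ltnW //; case/andP: kp.
have nzk : z ^+ k != 0.
  by apply: contraTneq (oner_neq0 algC) => e; rewrite -zz e mulr0 eqxx.
have zk : z ^+ (p - k) = (z ^+ k)^-1 by apply: (mulIf nzk); rewrite zz mulVf.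
rewrite !(mulnC _ k) !(mulnC _ (p - k)%N) !exprM zk !expr1.
move: (z ^+ k) nk nzk => y ny y0; split; field.
  by rewrite y0 ny subr_eq0 eq_sym -subr_eq0 ny.
by rewrite y0 ny subr_eq0 eq_sym -subr_eq0 ny.
Qed.

Lemma evalr_qsum_sym (r : rel nat) a b t :
  (forall x y, (0 < x <= p - 1)%N -> (0 < y <= p - 1)%N ->
     r ((p - 1).+1 - y)%N ((p - 1).+1 - x)%N = r x y) ->
  t = (a + b + 1)%N ->
  evalr z (qsum r (p - 1) (nseq a 2%N ++ 3%N :: nseq b 2%N)
            + qsum r (p - 1) (nseq b 2%N ++ 3%N :: nseq a 2%N))
    (- (1 - z) * chain r (p - 1) t (fun=> qterm 2)).
Proof.
move=> rP Dt.
rewrite -(chain_sym_add (y := qterm 3) rP Dt); try by move=> k /qterm_flip[].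
have nthE c d i : (i < c + d + 1)%N ->
    nth 0%N (nseq c 2%N ++ 3%N :: nseq d 2%N) i = if i == c then 3 else 2.
  move=> lt_i; rewrite nth_cat size_nseq nth_nseq; case: ltngtP => [//||->].
    case Di: (i - c)%N => [|j] lt_ci; first by lia.
    by rewrite /= nth_nseq ifT //; lia.
  by rewrite subnn.
apply: evalrD.
  rewrite -(@chain_ext _ r (p - 1) t
    (fun i => qterm (nth 0%N (nseq a 2%N ++ 3%N :: nseq b 2%N) i))).
    by apply: evalr_qsum; rewrite size_cat /= !size_nseq; lia.
  by move=> i lt_it k; rewrite nthE -?Dt //; case: eqP.
rewrite -(@chain_ext _ r (p - 1) t
    (fun i => qterm (nth 0%N (nseq b 2%N ++ 3%N :: nseq a 2%N) i))).
  by apply: evalr_qsum; rewrite size_cat /= !size_nseq; lia.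
by move=> i lt_it k; rewrite nthE; [case: eqP|lia].
Qed.

Lemma psum_qterm2 r N l lo :
  psum r N l lo (qterm 2) = (1 - z) ^+ (2 * l) * psum r N l lo (xval z).
Proof.
rewrite exprM -psumZ; apply: eq_bigr => k _; apply: eq_bigr => i _; exact: qterm2.
Qed.

Lemma elementary_xval t : (t < p)%N ->
  psum ltn p t 0 (xval z)
    = (-1) ^+ t * 'C(p + t, 2 * t + 1)%:R / (p%:R * (t%:R + 1)).
Proof.
move=> lt_tp; have np : p%:R != 0 :> algC by rewrite pnatr_eq0 -lt0n.
have nt : t%:R + 1 != 0 :> algC by rewrite natr1 pnatr_eq0.
(* The sign goes into the variables, because [psum_ltn] has factors 1 + x X and the product formula
   1 - x X; [psumZ] extracts it as (-1)^t. *)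
have e : p%:R ^+ 2 * psum ltn p t 0 (fun k => -1 * xval z k) = (chebc p t)%:R.
  rewrite psum_ltn // -coefZ.
  under eq_bigr do rewrite mulN1r scaleNr.
  by rewrite prod_xval_chebc // coef_poly lt_tp.
have := congr1 (fun k => k%:R : algC) (chebc_bin lt_tp).
rewrite !natrM -natr1 -e psumZ => e'.
have sgn : (-1) ^+ t * (-1) ^+ t = 1 :> algC by rewrite -expr2 sqrr_sign.
have -> : 'C(p + t, 2 * t + 1)%:R = p%:R * ((-1) ^+ t * psum ltn p t 0 (xval z)) * (t%:R + 1).
  by apply: (mulfI np); rewrite -e'; ring.
set E := psum _ _ _ _ _; transitivity ((-1) ^+ t * (-1) ^+ t * E); first by rewrite sgn mul1r.
by field; rewrite nt np.
Qed.

Lemma complete_xval t K : (0 < t)%N -> is_Kseq p K ->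
  psum leq p t 1 (xval z) = ratr (\sum_(0 <= i < t.+1)
         (t%:R * 'C(t - 1, i)%:R + (t%:R - 1) * 'C(t, i)%:R)
         * (-1) ^+ i * K (2 * t - i)%N).
Proof.
(* [f] absorbs the sign (-1)^(n-1) and so lists the plain Taylor coefficients about 1. *)
move=> t_gt0 [_ hK]; pose f n : algC := ratr ((-1) ^ (n%:Z - 1) * K n).
have np : p%:R != 0 :> algC by rewrite pnatr_eq0 -lt0n.
rewrite (@complete_coef _ p t f (fun l => psum leq p l 1 (xval z))) //.
- rewrite big_mkord rmorph_sum; apply: eq_bigr => i _.
  have le_it : (i <= t)%N by rewrite -ltnS ltn_ord.
  have sgn : (-1) ^ ((2 * t - i)%N%:Z - 1) = - (-1) ^+ i :> rat.
    rewrite expfzDr // -exprnP mulrN1 -(signr_odd _ (2 * t - i)) oddB; last by lia.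
    by rewrite oddM /= signr_odd.
  transitivity (ratr
    ('C(t, i)%:R * ((1 - (2 * t - i)%:R) * (- (-1) ^+ i * K (2 * t - i)%N))) : algC).
    by rewrite /f sgn !rmorphM rmorphB rmorph1 /= !ratr_nat.
  congr ratr.
  (* By t C(t-1, i) = (t-i) C(t, i), the bracket of the sum is (2t-1-i) C(t, i). *)
  have := congr1 (fun k => k%:R : rat) (mul_bin_down t i).
  rewrite -subn1 !natrM !natrB //; last by lia.
  rewrite natrM => ->; ring.
(* Substituting 'X + 1 moves the expansion point from 1 to 0. *)
- move=> n; have := congr1 (ratr : rat -> algC) (hK n).
  have comp1 (q : {poly rat}) : 1 \Po q = 1 by rewrite -polyC1 comp_polyC.
  have -> : ('X^p - 1 : {poly rat}) \Po ('X + 1%:P) = (1 + 'X) ^+ p - 1.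
    by rewrite comp_polyB comp1 comp_Xn_poly polyC1 ['X + 1]addrC.
  have -> : (p%:R *: ('X - 1) : {poly rat}) \Po ('X + 1%:P) = p%:R *: 'X.
    by rewrite comp_polyZ comp_polyB comp1 comp_polyX polyC1 addrK.
  rewrite -!coef_map /= rmorph_sum /= => e.
  have -> : (p%:R *: 'X : {poly algC}) = map_poly ratr (p%:R *: 'X : {poly rat}).
    by rewrite linearZ /= map_polyX ratr_nat.
  rewrite -e; apply: eq_bigr => i _.
  rewrite rmorphM -[in RHS]coef_map rmorphB rmorphXn rmorphD rmorph1 /= map_polyX.
  by [].

move=> i lt_it; rewrite -(prod_xval_chebc p_pr z_prim) -scalerAl coefZ.
by rewrite (@psum_leq _ p t.+1 1).
Qed.

End AtRootOfUnity.

Theorem theorem6p1 (a b t p : nat) (K : nat -> rat)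
  (ht : t = (a + b + 1)%N) (hp : prime p) (hpt : (2 * t + 1 < p)%N)
  (hK : is_Kseq p K) :
  ratfun_eqmod p
    (Hq (p - 1) (nseq a 2%N ++ 3%N :: nseq b 2%N)
     + Hq (p - 1) (nseq b 2%N ++ 3%N :: nseq a 2%N))
    ((-1) ^+ (t - 1) * 'C(p + t, 2 * t + 1)%:R
     * ((1 - ratq) ^+ (2 * t + 1) / (p%:R * (t%:R + 1))))
  /\
  ratfun_eqmod p
    (Sq (p - 1) (nseq a 2%N ++ 3%N :: nseq b 2%N)
     + Sq (p - 1) (nseq b 2%N ++ 3%N :: nseq a 2%N))
    (- (1 - ratq) ^+ (2 * t + 1)
     * ratconst (\sum_(0 <= i < t.+1)
         (t%:R * 'C(t - 1, i)%:R + (t%:R - 1) * 'C(t, i)%:R)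
         * (-1) ^+ i * K (2 * t - i)%N)).
Proof.
have [z z_prim] := C_prim_root_exists (prime_gt0 hp).
have pK : ((p - 1).+1 = p)%N by have := prime_gt0 hp; lia.
have t_gt0 : (0 < t)%N by lia.
have q1 : evalr z ((1 - ratq) ^+ (2 * t + 1)) ((1 - z) ^+ (2 * t + 1)).
  by apply/evalrX/evalrD; [apply: (evalr_int z 1)|apply/evalrN/evalr_ratq].
have evalr_nat n : evalr z n%:R n%:R := evalr_int z n.
split; apply: (eqmod_evalr hp z_prim).
- apply: (evalr_qsum_sym hp z_prim) ht => x y x_n y_n; apply/idP/idP; lia.
- rewrite chain_psum_ltn pK psum_qterm2 (elementary_xval hp z_prim); last by lia.
  (* The sign from the reversal and (-1)^t from [elementary_xval] combine to (-1)^(t-1), as t >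
     0. *)
  rewrite (_ : _ * _ = (-1) ^+ (t - 1) * 'C(p + t, 2 * t + 1)%:R
     * ((1 - z) ^+ (2 * t + 1) / (p%:R * (t%:R + 1)))); last first.
    have [m ->] : exists m, t = m.+1 by exists t.-1; lia.
    rewrite subn1 addn1 !exprS /=; ring.
  apply: evalrM; first by apply: evalrM => //; apply/evalrX/(evalr_int z (-1)).
  apply: evalrM => //; apply: evalrV.
    by rewrite mulf_neq0 ?natr1 // pnatr_eq0 // -lt0n prime_gt0.
  by apply: evalrM => //; apply: evalrD (evalr_nat t) (evalr_nat 1%N).
- apply: (evalr_qsum_sym hp z_prim) ht => x y x_n y_n; apply/idP/idP; lia.
rewrite chain_psum_leq pK psum_qterm2 (complete_xval hp z_prim t_gt0 hK) mulrA.
have -> : - (1 - z) * (1 - z) ^+ (2 * t) = - (1 - z) ^+ (2 * t + 1).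
  by rewrite addn1 exprS mulNr.
by apply: evalrM; [apply: evalrN|apply: evalr_const].
Qed.
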